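(* For every fixed $d\ge2$ there is a constant $c_d>0$ such that for infinitely many values of $n$ there is an $n$-point set $P\subset[0,1]^d$ with \[ \operatorname{disc}_{2,\overline{w}}\mathcal{A}_d(P)\ge c_d\log^{d-1}n . \]
   Context: For $x\in[0,1]^d$ let $A(x)=[0,x_1]\times\cdots\times[0,x_d]$. For a finite $P\subset[0,1]^d$, $\mathcal{A}_d(P)=\{A(x)\cap P: x\in[0,1]^d\}$ (the set system on $P$ induced by anchored boxes), and $\overline{w}:\mathcal{A}_d(P)\to[0,1]$ is the weight $\overline{w}(F)=\lambda^d\{x\in[0,1]^d: A(x)\cap P=F\}$, where $\lambda^d$ is Lebesgue measure. For a set system $\mathcal{F}$ on a ground set $V$ and a nonnegative weight $w:\mathcal{F}\to[0,\infty)$ not identically zero, $\operatorname{disc}_{p,w}\mathcal{F}=\min_{x\in\{-1,1\}^V}\bigl(\frac{1}{w(\mathcal{F})}\sum_{F\in\mathcal{F}}w(F)|x(F)|^p\bigr)^{1/p}$, where $x(F)=\sum_{v\in F}x_v$ and $w(\mathcal{F})=\sum_{F\in\mathcal{F}}w(F)$. *)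

(* Defs.v *)
From HB Require Import structures.
From mathcomp Require Import all_boot all_order all_algebra.
From mathcomp Require Import all_classical all_reals all_analysis.
Set Implicit Arguments. Unset Strict Implicit. Unset Printing Implicit Defensive.
Import Order.TTheory GRing.Theory Num.Theory.
Local Open Scope classical_set_scope.
Local Open Scope ring_scope.

Section Disc.
Variable R : realType.

(* d-dimensional Lebesgue measure of S ∩ [0,1]^d, computed as the iterated
   Lebesgue integral of the indicator of S (Tonelli); points are sequences. *)
Fixpoint vol_seq (d : nat) (S : set (seq R)) : \bar R :=
  match d with
  | 0 => (\1_S [::] : R)%:E
  | d'.+1 => (\int[lebesgue_measure]_(t in `[0%R, 1%R]%classic)
                 vol_seq d' [set y | S (t :: y)])%E
  end.

Definition lebd (d : nat) (S : set (d.-tuple R)) : \bar R :=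
  vol_seq d [set s | exists t : d.-tuple R, tval t = s /\ S t].

Definition in_unit_cube d (x : d.-tuple R) : Prop :=
  forall i : 'I_d, 0 <= tnth x i <= 1.

Definition in_anchored_box d (x p : d.-tuple R) : Prop :=
  forall i : 'I_d, 0 <= tnth p i <= tnth x i.

(* The point set P = {p i | i < n}, given by an injective indexing p;
   subsets of P are identified with subsets of 'I_n. *)
Definition trace d n (p : 'I_n -> d.-tuple R) (x : d.-tuple R) : {set 'I_n} :=
  [set i | `[< in_anchored_box x (p i) >]].

Definition anchored_system d n (p : 'I_n -> d.-tuple R) : {set {set 'I_n}} :=
  [set F | `[< exists x : d.-tuple R, in_unit_cube x /\ trace p x = F >]].

Definition wbar d n (p : 'I_n -> d.-tuple R) (F : {set 'I_n}) : R :=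
  fine (lebd [set x | in_unit_cube x /\ trace p x = F]).

Definition colsum n (col : {ffun 'I_n -> bool}) (F : {set 'I_n}) : R :=
  \sum_(i in F) (if col i then 1 else -1).

Definition disc2_val n (Fs : {set {set 'I_n}}) (w : {set 'I_n} -> R)
    (col : {ffun 'I_n -> bool}) : R :=
  Num.sqrt ((\sum_(F in Fs) w F)^-1 *
            \sum_(F in Fs) w F * `|colsum col F| ^+ 2).

Definition disc2 n (Fs : {set {set 'I_n}}) (w : {set 'I_n} -> R) : R :=
  disc2_val Fs w (Order.arg_min [ffun=> true] xpredT (disc2_val Fs w)).

End Disc.

(* Main.v *)
Require Import Defs.
From HB Require Import structures.
From mathcomp Require Import all_boot all_order all_algebra.
From mathcomp Require Import all_classical all_reals all_analysis.
From mathcomp Require Import measurable_realfun ring lra zify.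
Set Implicit Arguments. Unset Strict Implicit. Unset Printing Implicit Defensive.
Import Order.TTheory GRing.Theory Num.Theory.
Import numFieldNormedType.Exports.
Local Open Scope ring_scope.

(** All points lie on the grid [{0, 1/M, ..., (M-1)/M}^d], so that the square of
    the discrepancy of a colouring is the mean of [D(x)^2] over [x] in
    [{0..M-1}^d], where [D(x)] is the sum of the colours of the points below [x].

    In one dimension, with [h = pi/(2M)], the functions [cos(l(2k+1)h)] are
    orthogonal, so are the functions [sin(2lkh)], and summing the former over
    [k >= p] gives [- sin(2lph) / (2 sin(lh))], of order [M/l].  Tensor products
    over the hyperbolic cross of the [l] with [l_1 ... l_d <= Q], which has
    [N >= c Q log^(d-1) Q] elements, and Bessel's inequality bound the mean of
    [D^2] below by [c Q^-2 |sum_p col(p) v(p)|^2], where [v(p)] in [R^N] has the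
    coordinates [prod_i sin(2 l_i p_i h)].

    The second orthogonality says that the [v(p)] are in isotropic position, so
    [N/2] points can be picked greedily, each [v(p)] at squared distance at least
    [c N] from the span of the previous ones.  If every subset of these had a
    colouring with [|sum_p col(p) v(p)|^2 < c' N^2], then rounding binary digits
    one by one would bring every point of [{0..15}^n] close to a point of
    [{0,16}^n]; but the triangular shape of the system leaves at most [6^n]
    integer points close to a given one, and [12^n < 16^n].  Hence some subset has
    discrepancy at least [c N / Q]. *)

(** * Orthogonal families and greedy selection *)

Definition ffcons (T : Type) n (t : T) (x : {ffun 'I_n -> T}) : {ffun 'I_n.+1 -> T} :=
  [ffun i => if unlift ord0 i is Some j then x j else t].

Lemma ffcons0 (T : Type) n (t : T) (x : {ffun 'I_n -> T}) : ffcons t x ord0 = t.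
Proof. by rewrite ffunE unlift_none. Qed.

Lemma ffconsS (T : Type) n (t : T) (x : {ffun 'I_n -> T}) i :
  ffcons t x (lift ord0 i) = x i.
Proof. by rewrite ffunE liftK. Qed.

Lemma big_ffcons (V : Type) (idx : V) (op : Monoid.com_law idx) (T : finType) n
    (F : {ffun 'I_n.+1 -> T} -> V) :
  \big[op/idx]_x F x = \big[op/idx]_t \big[op/idx]_x F (ffcons t x).
Proof.
rewrite pair_big /=.
rewrite (reindex (fun q : T * {ffun 'I_n -> T} => ffcons q.1 q.2)) //=.
exists (fun x : {ffun 'I_n.+1 -> T} => (x ord0, [ffun i => x (lift ord0 i)])).
  move=> [t x] _ /=; rewrite ffcons0; congr (_, _).
  by apply/ffunP => i; rewrite ffunE ffconsS.
move=> x _; apply/ffunP => i /=.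
by case: (unliftP ord0 i) => [j ->|->]; rewrite ?ffconsS ?ffcons0 ?ffunE.
Qed.

Section InnerProduct.
Variable R : rcfType.

Definition dot (I : finType) (u v : I -> R) : R := \sum_l u l * v l.

Definition orthofam (J I : finType) (k : R) (b : J -> I -> R) : Prop :=
  forall i j, dot (b i) (b j) = k *+ (i == j).

Lemma dotC (I : finType) (u v : I -> R) : dot u v = dot v u.
Proof. by apply: eq_bigr => l _; rewrite mulrC. Qed.

Lemma eq_dotl (I : finType) (u u' v : I -> R) : u =1 u' -> dot u v = dot u' v.
Proof. by move=> e; apply: eq_bigr => l _; rewrite e. Qed.

Lemma dot_ge0 (I : finType) (u : I -> R) : 0 <= dot u u.
Proof. by apply: sumr_ge0 => l _; rewrite -expr2 sqr_ge0. Qed.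

Lemma dot_suml (I J : finType) (c : J -> R) (b : J -> I -> R) (v : I -> R) :
  dot (fun x => \sum_j c j * b j x) v = \sum_j c j * dot (b j) v.
Proof.
rewrite /dot; under eq_bigr => l _ do rewrite mulr_suml.
rewrite exchange_big /=; apply: eq_bigr => j _.
by rewrite mulr_sumr; apply: eq_bigr => l _; rewrite mulrA.
Qed.

Lemma dot_orthofam (I J : finType) k (b : J -> I -> R) (c : J -> R) i :
  orthofam k b -> dot (fun x => \sum_j c j * b j x) (b i) = k * c i.
Proof.
move=> ob; rewrite dot_suml (bigD1 i) //= big1 => [|j ji].
  by rewrite ob eqxx mulr1n addr0 mulrC.
by rewrite ob (negbTE ji) mulr0n mulr0.
Qed.

Lemma dot_comb (I J : finType) k (b : J -> I -> R) (c : J -> R) :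
  orthofam k b ->
  dot (fun x => \sum_j c j * b j x) (fun x => \sum_j c j * b j x)
  = k * \sum_j c j ^+ 2.
Proof.
move=> ob; rewrite dot_suml mulr_sumr; apply: eq_bigr => j _.
by rewrite dotC (dot_orthofam _ _ ob) expr2; ring.
Qed.

(** Pythagoras: the subtracted sum is the orthogonal projection of [u] on the span of [b], so this
    is the squared distance of [u] from that span. *)
Lemma dot_residual (I J : finType) (b : J -> I -> R) (u : I -> R) :
  orthofam 1 b ->
  dot (fun x => u x - \sum_j dot u (b j) * b j x)
      (fun x => u x - \sum_j dot u (b j) * b j x)
  = dot u u - \sum_j dot u (b j) ^+ 2.
Proof.
move=> ob; pose w x := \sum_j dot u (b j) * b j x.
have -> : dot (fun x => u x - w x) (fun x => u x - w x)
    = dot u u - dot w u *+ 2 + dot w w.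
  rewrite /dot -sumrMnl -sumrB -big_split /=; apply: eq_bigr => l _; ring.
rewrite [dot w w](dot_comb _ ob) mul1r dot_suml.
have -> : \sum_j dot u (b j) * dot (b j) u = \sum_j dot u (b j) ^+ 2.
  by apply: eq_bigr => j _; rewrite (dotC (b j)) expr2.
ring.
Qed.

Lemma bessel (I J : finType) k (b : J -> I -> R) (u : I -> R) :
  0 < k -> orthofam k b -> \sum_j dot u (b j) ^+ 2 <= k * dot u u.
Proof.
move=> k0 ob; pose s := Num.sqrt k.
have s0 : 0 < s by rewrite sqrtr_gt0.
have ss : s ^+ 2 = k by rewrite sqr_sqrtr // ltW.
pose b' j x := s^-1 * b j x.
have dot_b' v j : dot v (b' j) = s^-1 * dot v (b j).
  by rewrite /dot mulr_sumr; apply: eq_bigr => x _; rewrite /b'; ring.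
have ob' : orthofam 1 b'.
  move=> i j; rewrite dot_b' dotC dot_b' dotC ob -ss.
  case: (i == j); rewrite ?mulr0n ?mulr0 // !mulr1n; field; exact: lt0r_neq0.
have := dot_ge0 (fun x => u x - \sum_j dot u (b' j) * b' j x).
rewrite dot_residual // subr_ge0 => le_u.
rewrite -ss -ler_pdivrMl ?exprn_gt0 //; apply: le_trans le_u.
rewrite mulr_sumr; apply: ler_sum => j _; by rewrite dot_b' exprMn exprVn.
Qed.

(* Averaging over [x]: the squared distances of the [f x] to the span of [e]
   add up to [k * (#|I| - n)]. *)
Lemma exists_far (X I : finType) n k (f : X -> I -> R) (e : 'I_n -> I -> R) :
  (0 < #|X|)%N -> orthofam k (fun l x => f x l) -> orthofam 1 e ->
  exists x, k * (#|I|%:R - n%:R) / #|X|%:R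
            <= dot (f x) (f x) - \sum_i dot (f x) (e i) ^+ 2.
Proof.
move=> X0 of_ oe.
have total : \sum_x (dot (f x) (f x) - \sum_i dot (f x) (e i) ^+ 2)
    = k * (#|I|%:R - n%:R).
  rewrite sumrB mulrBr; congr (_ - _).
    rewrite /dot exchange_big /= (eq_bigr (fun=> k)) => [|l _].
      by rewrite sumr_const mulr_natr.
    by have := of_ l l; rewrite /dot eqxx mulr1n.
  rewrite exchange_big /= (eq_bigr (fun=> k)) => [|i _].
    by rewrite sumr_const card_ord mulr_natr.
  have := dot_comb (e i) of_.
  have -> : \sum_j e i j ^+ 2 = 1 by have := oe i i; rewrite eqxx mulr1n.
  rewrite mulr1 => <-; apply: eq_bigr => x _; rewrite expr2.
  by congr (_ * _); apply: eq_bigr => l _; rewrite mulrC.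
case: (boolP [exists x, k * (#|I|%:R - n%:R) / #|X|%:R
            <= dot (f x) (f x) - \sum_i dot (f x) (e i) ^+ 2]).
  by move/existsP.
rewrite negb_exists => /forallP small; exfalso.
have [x0 _] := card_gt0P X0.
have : \sum_x (dot (f x) (f x) - \sum_i dot (f x) (e i) ^+ 2)
    < \sum_(x : X) (k * (#|I|%:R - n%:R) / #|X|%:R).
  apply: ltr_sum; first by apply/hasP; exists x0; rewrite ?mem_index_enum.
  by move=> x _; rewrite ltNge small.
rewrite total sumr_const -[X in _ < X]mulr_natr.
by rewrite divfK ?ltxx // pnatr_eq0 -lt0n.
Qed.

(** Induction on [n]: [exists_far] supplies a vector far from the span of the previous [e], and its
    normalised residual is the next [e]. Hence [f (p j)] lies in the span of [e 0, ..., e j], and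
    its squared diagonal entry is its squared distance from the earlier span. *)
Lemma gram_schmidt (X I : finType) k (f : X -> I -> R) n (D : R) :
  (0 < #|X|)%N -> 0 < D -> orthofam k (fun l x => f x l) ->
  (forall i, (i < n)%N -> D <= k * (#|I|%:R - i%:R) / #|X|%:R) ->
  exists (p : nat -> X) (e : nat -> I -> R),
  [/\ forall i j, (i < n)%N -> (j < n)%N -> dot (e i) (e j) = (i == j)%:R,
      forall j l, (j < n)%N ->
        f (p j) l = \sum_(i < n) dot (f (p j)) (e i) * e i l,
      forall i j, (j < i < n)%N -> dot (f (p j)) (e i) = 0
    & forall i, (i < n)%N -> D <= dot (f (p i)) (e i) ^+ 2].
Proof.
move=> X0 D0 of_; elim: n => [|n IH] hD.
  have [x0 _] := card_gt0P X0.
  exists (fun=> x0), (fun=> fun=> 0).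
  by split=> // i j; rewrite ltn0 andbF.
have [i lin|p [e [oe span tri far]]] := IH.
  by apply: hD; rewrite ltnS ltnW.
have oe' : orthofam 1 (fun i : 'I_n => e i).
  by move=> i j; rewrite oe // .
have [x farx] := exists_far X0 of_ oe'.
have {farx} farx := le_trans (hD n (ltnSn n)) farx.
pose r l := f x l - \sum_(i < n) dot (f x) (e i) * e i l.
move: farx; rewrite -(dot_residual (f x) oe') -/r => farx.
pose s := Num.sqrt (dot r r).
have rr0 : 0 < dot r r by apply: lt_le_trans farx.
have s0 : 0 < s by rewrite sqrtr_gt0.
have ss : s ^+ 2 = dot r r by rewrite sqr_sqrtr // ltW.
pose en l := s^-1 * r l.
have dot_en v : dot v en = s^-1 * dot v r.
  by rewrite /dot mulr_sumr; apply: eq_bigr => l _; rewrite /en; ring.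
have r_e i : (i < n)%N -> dot r (e i) = 0.
  move=> lin; have -> : dot r (e i) = dot (f x) (e i)
      - dot (fun l => \sum_(i < n) dot (f x) (e i) * e i l) (e i).
    by rewrite /dot -sumrB; apply: eq_bigr => l _; rewrite mulrBl.
  by rewrite (dot_orthofam _ (Ordinal lin) oe') mul1r subrr.
have r_fx : dot (f x) r = s ^+ 2.
  have -> : dot (f x) r
      = dot r r + dot (fun l => \sum_(i < n) dot (f x) (e i) * e i l) r.
    by rewrite /dot -big_split /=; apply: eq_bigr => l _; rewrite /r; ring.
  rewrite dot_suml big1 ?addr0 ?ss // => i _.
  by rewrite (dotC _ r) r_e ?mulr0.
have r_fp j : (j < n)%N -> dot (f (p j)) r = 0.
  move=> lin; rewrite (eq_dotl _ (span j ^~ lin)) dot_suml big1 // => i _.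
  by rewrite (dotC _ r) r_e ?mulr0.
exists (fun i => if (i < n)%N then p i else x),
       (fun i => if (i < n)%N then e i else en).
split.
- move=> i j; rewrite !ltnS => hi hj.
  case: (ltnP i n) => hi'; case: (ltnP j n) => hj'.
  + exact: oe.
  + by rewrite dot_en dotC r_e // mulr0 (ltn_eqF (leq_trans hi' hj')).
  + by rewrite dotC dot_en dotC r_e // mulr0 (gtn_eqF (leq_trans hj' hi')).
  + have -> : i = j by lia.
    by rewrite dot_en dotC dot_en eqxx -ss /=; field; exact: lt0r_neq0.
- move=> j l; rewrite ltnS => hj; rewrite big_ord_recr /= ltnn.
  rewrite (eq_bigr (fun i : 'I_n =>
     dot (f (if (j < n)%N then p j else x)) (e i) * e i l)); last first.
    by move=> i _; rewrite ltn_ord.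
  case: (ltnP j n) => hj'; first by rewrite dot_en r_fp // mulr0 mul0r addr0 -span.
  rewrite dot_en r_fx /en /r; field; exact: lt0r_neq0.
- move=> i j /andP[ji]; rewrite ltnS => lin.
  rewrite (leq_trans ji lin); case: (ltnP i n) => hi.
    by apply: tri; rewrite ji.
  by rewrite dot_en r_fp ?mulr0 // (leq_trans ji lin).
- move=> i; rewrite ltnS => lin; case: (ltnP i n) => hi; first exact: far.
  rewrite dot_en r_fx; have -> : s^-1 * s ^+ 2 = s by field; exact: lt0r_neq0.
  by rewrite ss.
Qed.

End InnerProduct.

(** * Subsets without balanced colourings *)

Section Hereditary.
Variable R : rcfType.

(** Two steps of [t] move the form by at least [2 sqrt D], the width of the open interval where its
    square is below [D]; so such [t] are at most two neighbours. *)
Lemma card_small_affine m (a c D : R) : 0 < D -> D <= a ^+ 2 ->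
  (#|[set t : 'I_m | ((t%:R * a + c) ^+ 2 < D)%R]| <= 2)%N.
Proof.
move=> D0 Da; set A := [set t : 'I_m | _].
have sep (s t : 'I_m) : s \in A -> t \in A -> (s <= t)%N -> (t <= s.+1)%N.
  rewrite !inE => hs ht st; rewrite leqNgt; apply/negP => st2.
  pose u : R := t%:R - s%:R.
  have u2 : 2 <= u.
    by rewrite lerBrDr -natrD ler_nat addnC addn2.
  have : 4 * D <= (u * a) ^+ 2.
    rewrite exprMn; apply: ler_pM => //; [exact: ltW|].
    by have := ler_pM (ler0n _ 2) (ler0n _ 2) u2 u2; rewrite -expr2; lra.
  have -> : u * a = (t%:R * a + c) - (s%:R * a + c) by rewrite /u; ring.
  move: (_ + c) hs (_ + c) ht => x hx y hy.
  have := sqr_ge0 (x + y).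
  have -> : (x + y) ^+ 2 = 2 * x ^+ 2 + 2 * y ^+ 2 - (y - x) ^+ 2 by ring.
  lra.
case: (set_0Vmem A) => [->|[s0 s0A]]; first by rewrite cards0.
have [s sA smin] := arg_minnP (fun t : 'I_m => nat_of_ord t) s0A.
have /subset_leq_card/leq_trans -> // :
    A \subset s |: [set t : 'I_m | t == s.+1 :> nat].
  apply/fintype.subsetP => t tA; have := sep _ _ sA tA (smin _ tA).
  rewrite !inE leq_eqVlt ltnS => /orP[->|ts]; first by rewrite orbT.
  by apply/orP; left; rewrite -val_eqE /= eqn_leq ts smin.
rewrite cardsU1; apply: (@leq_add _ _ 1 1); first exact: leq_b1.
apply/card_le1_eqP => x y; rewrite !inE => /eqP ex /eqP ey.
by apply: val_inj; rewrite /= ex ey.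
Qed.

(** At most two [t] carry the weight 16, so the sum is at most [16 * 1 + 2 * 16]. *)
Lemma sum_affine_weight (a c D : R) : 0 < D -> D <= a ^+ 2 ->
  (\sum_(t < 16) (if (D <= (t%:R * a + c) ^+ 2)%R then 1 else 16) <= 48)%N.
Proof.
move=> D0 Da.
have := card_small_affine 16 c D0 Da; rewrite -sum1_card => cardA.
apply: (@leq_trans (\sum_(t < 16) 1 +
  16 * \sum_(t in [set t : 'I_16 | ((t%:R * a + c) ^+ 2 < D)%R]) 1)%N).
  rewrite big_distrr /= [X in (_ <= _ + X)%N]big_mkcond -big_split /=.
  apply: leq_sum => t _; rewrite inE leNgt.
  by case: (_ < D).
rewrite [X in (X + _)%N]sum1_card card_ord; lia.
Qed.

(* Summing over the coordinate [x 0] first, which only enters the form of index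
   [0], costs a factor 48 for each form. *)
Lemma sum_triangular_weight n (a : 'I_n -> 'I_n -> R) (c : 'I_n -> R) D :
  0 < D -> (forall i, D <= a i i ^+ 2) ->
  (forall i j : 'I_n, (j < i)%N -> a j i = 0) ->
  (\sum_(x : {ffun 'I_n -> 'I_16})
     \prod_(i < n) (if (D <= (\sum_j (x j)%:R * a j i + c i) ^+ 2)%R then 1 else 16)
   <= 48 ^ n)%N.
Proof.
move=> D0; elim: n a c => [|n IH] a c da ta.
  rewrite (eq_bigr (fun=> 1%N)) => [|x _]; last by rewrite big_ord0.
  by rewrite sum1_card card_ffun !card_ord expn0.
rewrite big_ffcons exchange_big /=.
pose w (x : {ffun 'I_n -> 'I_16}) (i : 'I_n) := if D <=
  (\sum_j (x j)%:R * a (lift ord0 j) (lift ord0 i) + c (lift ord0 i)) ^+ 2 then 1%N else 16%N.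
have split (x : {ffun 'I_n -> 'I_16}) (t : 'I_16) :
    (\prod_(i < n.+1)
      (if (D <= (\sum_j (ffcons t x j)%:R * a j i + c i) ^+ 2)%R then 1 else 16)
    = (if (D <= (t%:R * a ord0 ord0 +
        (\sum_j (x j)%:R * a (lift ord0 j) ord0 + c ord0)) ^+ 2)%R then 1 else 16)
      * \prod_(i < n) w x i)%N.
  rewrite big_ord_recl big_ord_recl ffcons0 addrA; congr (_ * _)%N.
    by under eq_bigr => i _ do rewrite ffconsS.
  apply: eq_bigr => i _; rewrite big_ord_recl ta // mulr0 add0r.
  by under eq_bigr => j _ do rewrite ffconsS.
apply: (@leq_trans (\sum_(x : {ffun 'I_n -> 'I_16}) 48 * \prod_(i < n) w x i)%N).
  apply: leq_sum => x _; under eq_bigr => t _ do rewrite split.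
  by rewrite -big_distrl /= leq_mul2r sum_affine_weight ?orbT.
rewrite -big_distrr expnS leq_mul2l /=.
by apply: (IH (fun j i => a (lift ord0 j) (lift ord0 i))
  (fun i => c (lift ord0 i))) => // i j ji; apply: ta.
Qed.

Definition normsq n (I : finType) (v : 'I_n -> I -> R) (x : 'I_n -> R) : R :=
  \sum_l (\sum_j x j * v j l) ^+ 2.

Lemma normsqD n (I : finType) (v : 'I_n -> I -> R) (x y : 'I_n -> R) :
  normsq v (fun j => x j + y j) <= 2 * normsq v x + 2 * normsq v y.
Proof.
rewrite /normsq !mulr_sumr -big_split /=; apply: ler_sum => l _.
under eq_bigr => j _ do rewrite mulrDl.
rewrite big_split /=; set s := \sum_j x j * _; set t := \sum_j y j * _.
rewrite -subr_ge0; have -> : 2 * s ^+ 2 + 2 * t ^+ 2 - (s + t) ^+ 2 = (s - t) ^+ 2.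
  by ring.
exact: sqr_ge0.
Qed.

Lemma normsqZ n (I : finType) (v : 'I_n -> I -> R) (k : R) (x : 'I_n -> R) :
  normsq v (fun j => k * x j) = k ^+ 2 * normsq v x.
Proof.
rewrite /normsq mulr_sumr; apply: eq_bigr => l _; rewrite -exprMn mulr_sumr.
by congr (_ ^+ 2); apply: eq_bigr => j _; rewrite mulrA.
Qed.

Lemma eq_normsq n (I : finType) (v : 'I_n -> I -> R) (x y : 'I_n -> R) :
  x =1 y -> normsq v x = normsq v y.
Proof.
by move=> e; apply: eq_bigr => l _; congr (_ ^+ 2); apply: eq_bigr => j _; rewrite e.
Qed.

Definition sgb (b : bool) : R := if b then 1 else -1.

(* Round away the last binary digit by colouring the set of odd coordinates,
   halve, and iterate. *)
Lemma binary_rounding n (I : finType) (v : 'I_n -> I -> R) T k (x : 'I_n -> nat) :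
  0 <= T ->
  (forall S : {set 'I_n}, exists col : {ffun 'I_n -> bool},
     normsq v (fun j => if j \in S then sgb (col j) else 0) <= T) ->
  (forall j, (x j <= 2 ^ k)%N) ->
  exists z : {ffun 'I_n -> bool},
    normsq v (fun j => (x j)%:R - 2 ^+ k * (z j)%:R) <= (8 ^+ k - 1) * T.
Proof.
move=> T0 hT; elim: k x => [|k IH] x hx.
  exists [ffun j => x j == 1%N].
  rewrite expr0 subrr mul0r (@eq_normsq _ _ _ _ (fun=> 0)) => [|j].
    rewrite /normsq big1 // => l _; rewrite big1 ?expr0n // => j _.
    by rewrite mul0r.
  have := hx j; rewrite ffunE expn0 ?expr0 mul1r.
  by case: (x j) => [|[|]] //= _; rewrite subrr.
have [col hcol] := hT [set j | odd (x j)].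
(* Colour [+1] rounds an odd coordinate up and [-1] rounds it down. *)
pose y j := if odd (x j) then (if col j then (x j).+1./2 else (x j)./2) else (x j)./2.
have yE j : (x j)%:R = 2 * (y j)%:R - (if odd (x j) then sgb (col j) else 0) :> R.
  rewrite /y /sgb; have := odd_double_half (x j); case: ifP => /= ox xj.
    case: (col j).
      by rewrite uphalf_half ox add1n -[in LHS]xj -mul2n natrD natrM -natr1; ring.
    by rewrite -[in LHS]xj -mul2n natrD natrM; ring.
  by rewrite -[in LHS]xj -mul2n natrM subr0.
have [j|z hz] := IH y.
  by have := hx j; rewrite expnS /y; case: odd (odd_double_half (x j)); case: (col j); lia.
exists z.
rewrite (@eq_normsq _ _ _ _ (fun j => 2 * ((y j)%:R - 2 ^+ k * (z j)%:R)
   + (-1) * (if j \in [set j | odd (x j)] then sgb (col j) else 0))); last first.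
  by move=> j; rewrite inE yE exprS; ring.
apply: (le_trans (normsqD _ _ _)); rewrite !normsqZ.
(* Doubling costs a factor 4 and [normsqD] another 2, hence 8 per digit; the new colouring adds
   [2 * T], within the available [7 * T]. *)
have -> : (8 ^+ k.+1 - 1) * T = 2 * (4 * ((8 ^+ k - 1) * T)) + 2 * T + 5 * T.
  by rewrite exprS; ring.
lra.
Qed.

(** Weighted counting. Otherwise, rounding four digits pairs each [x] in [{0..15}^n] with a [z]
    whose squared forms add up to at most [4095 * T < D * n / 4]. So at most [n/4] forms are large,
    and the pair has weight at least [16 ^ (3n/4) = 8 ^ n]. But for each of the [2 ^ n] possible [z]
    the weights sum to at most [48 ^ n], while [16 * 8 > 2 * 48]. *)
Lemma exists_uncolorable_subset (I : finType) n (v e : 'I_n -> I -> R) (D : R) :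
  (0 < n)%N -> 0 < D -> orthofam 1 e ->
  (forall i j : 'I_n, (j < i)%N -> dot (v j) (e i) = 0) ->
  (forall i, D <= dot (v i) (e i) ^+ 2) ->
  exists S : {set 'I_n}, forall col : {ffun 'I_n -> bool},
    D * n%:R / 128 ^+ 2 <= \sum_l (\sum_(j in S) sgb (col j) * v j l) ^+ 2.
Proof.
move=> n0 D0 oe tri far; set T := D * n%:R / _.
have T0 : 0 <= T by rewrite /T !mulr_ge0 ?invr_ge0 ?exprn_ge0 ?ler0n // ltW.
have normsqE (S : {set 'I_n}) (col : {ffun 'I_n -> bool}) :
    normsq v (fun j => if j \in S then sgb (col j) else 0)
    = \sum_l (\sum_(j in S) sgb (col j) * v j l) ^+ 2.
  apply: eq_bigr => l _; congr (_ ^+ 2); rewrite [RHS]big_mkcond /=.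
  by apply: eq_bigr => j _; case: ifP => //; rewrite mul0r.
case: (boolP [exists S : {set 'I_n}, [forall col : {ffun 'I_n -> bool},
    T <= \sum_l (\sum_(j in S) sgb (col j) * v j l) ^+ 2]]).
  by case/existsP => S /forallP; exists S.
rewrite negb_exists => /forallP small; exfalso.
have colorable (S : {set 'I_n}) : exists col : {ffun 'I_n -> bool},
     normsq v (fun j => if j \in S then sgb (col j) else 0) <= T.
  have := small S; rewrite negb_forall => /existsP[col].
  by rewrite -ltNge => lt; exists col; rewrite normsqE ltW.
(* The coordinate along [e i] of the sum of the [(x j - 16 z j) v j]; the part with [z] is the
   constant of an affine form in [x]. *)
pose form (x : {ffun 'I_n -> 'I_16}) (z : {ffun 'I_n -> bool}) i : R :=
  \sum_j (x j)%:R * dot (v j) (e i) + - \sum_j 16 * (z j)%:R * dot (v j) (e i).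
pose w x z := (\prod_(i < n) (if (D <= form x z i ^+ 2)%R then 1 else 16))%N.
have w_large x : exists z, (8 ^ n <= w x z)%N.
  have [|z hz] := @binary_rounding _ _ v T 4 (fun j => x j) T0 colorable.
    by move=> j; apply: ltnW (ltn_ord _).
  exists z; set u := (fun l => \sum_j ((x j)%:R - 2 ^+ 4 * (z j)%:R) * v j l).
  have formE i : form x z i = dot u (e i).
    rewrite /u dot_suml /form -sumrN -big_split /=; apply: eq_bigr => j _.
    by rewrite -natrX; ring.
  have sum_form : \sum_i form x z i ^+ 2 <= (8 ^+ 4 - 1) * T.
    under eq_bigr => i _ do rewrite formE.
    apply: le_trans (le_trans (bessel u ltr01 oe) _) hz.
    by rewrite mul1r /dot /normsq; apply: ler_sum => l _; rewrite expr2.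
  pose B := [set i | D <= form x z i ^+ 2].
  have cardB : (4 * #|B| <= n)%N.
    have : D * #|B|%:R <= \sum_i form x z i ^+ 2.
      rewrite mulr_natr -sumr_const big_mkcond /=; apply: ler_sum => i _.
      by rewrite inE; case: ifP => // _; rewrite sqr_ge0.
    move=> /le_trans /(_ sum_form); rewrite /T => le.
    rewrite -(ler_nat R) natrM -(ler_pM2l D0).
    have Dn : 0 <= D * n%:R by rewrite mulr_ge0 ?ler0n ?ltW.
    move: le; have -> : (8 ^+ 4 - 1) * (D * n%:R / 128 ^+ 2) = D * n%:R * (4095 / 16384) :> R.
      by rewrite -!natrX; field.
    by nra.
  rewrite /w (bigID (mem B)) /= big1 => [|i]; last by rewrite inE => ->.
  rewrite mul1n (eq_bigr (fun=> 16%N)) => [|i]; last by rewrite inE => /negbTE ->.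
  rewrite prod_nat_const; set b := (X in (_ <= 16 ^ X)%N).
  have -> : b = (n - #|B|)%N.
    have := cardC B; rewrite card_ord; have -> : #|[predC B]| = b by apply: eq_card.
    lia.
  by rewrite -[8%N]/(2 ^ 3)%N -[16%N]/(2 ^ 4)%N -!expnM leq_exp2l //; lia.
have : (16 ^ n * 8 ^ n <= 2 ^ n * 48 ^ n)%N.
  apply: (@leq_trans (\sum_x \sum_z w x z)).
    have -> : (16 ^ n = #|{ffun 'I_n -> 'I_16}|)%N by rewrite card_ffun !card_ord.
    rewrite -sum_nat_const; apply: leq_sum => x _.
    have [z hz] := w_large x; apply: leq_trans hz _.
    by rewrite (bigD1 z) //= leq_addr.
  rewrite exchange_big /=.
  have -> : (2 ^ n = #|{ffun 'I_n -> bool}|)%N by rewrite card_ffun card_bool card_ord.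
  rewrite -sum_nat_const; apply: leq_sum => z _.
  exact: (sum_triangular_weight (a := fun j i => dot (v j) (e i))
    (fun i => - \sum_j 16 * (z j)%:R * dot (v j) (e i)) D0 far tri).
(* As [n > 0], the bases can be compared: [128 <= 96] is false. *)
by rewrite -!expnMn leq_exp2r.
Qed.

End Hereditary.

(** * Discrete cosines and sines *)

Section Trig.
Local Open Scope classical_set_scope.
Local Open Scope ring_scope.
Variable R : realType.

Lemma sin_le (x : R) : 0 <= x -> sin x <= x.
Proof.
move=> x0.
have dsin (y : R) : y \in `]0, x[ -> is_derive y 1 sin (cos y).
  by move=> _; exact: is_derive_sin.
have csin : {within `[0, x], continuous (@sin R)}.
  by apply: continuous_subspaceT => y; exact: continuous_sin.
have [c _] := MVT_segment x0 dsin csin.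
rewrite sin0 !subr0 => ->; have := cos_le1 c; nra.
Qed.

Lemma pi_le4 : pi <= 4 :> R.
Proof. have [/andP[_]] := pihalf_02_cos_pihalf R; lra. Qed.

Lemma sin_natpi n : sin (n%:R * pi) = 0 :> R.
Proof.
elim: n => [|n IH]; first by rewrite mul0r sin0.
by rewrite -natr1 mulrDl mul1r sinDpi IH oppr0.
Qed.

Lemma cos_natpi n : cos (n%:R * pi) = (-1) ^+ n :> R.
Proof.
elim: n => [|n IH]; first by rewrite mul0r cos0.
by rewrite -natr1 mulrDl mul1r cosDpi IH exprS mulN1r.
Qed.

Variable M : nat.
Hypothesis M0 : (0 < M)%N.

Let h : R := pi / (2 * M%:R).

Let MR0 : M%:R != 0 :> R. Proof. by rewrite pnatr_eq0 -lt0n. Qed.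

Let Mh : 2 * M%:R * h = pi.
Proof. by rewrite /h; field. Qed.

(** Cosines are sampled at the midpoints [(k + 1/2) / M] and sines at the left ends [k / M] (the
    DCT-II and DST-I bases); the half-step offset makes tail sums of [cosb] multiples of [sinb]. *)
Definition cosb (l k : nat) : R := cos (l%:R * (2 * k%:R + 1) * h).
Definition sinb (l k : nat) : R := sin (2 * l%:R * k%:R * h).
Definition sinhalf (l : nat) : R := sin (l%:R * h).

Lemma sinhalf_gt0 l : (0 < l < 2 * M)%N -> 0 < sinhalf l.
Proof.
move=> /andP[l0 lM]; have h0 : 0 < h.
  by rewrite divr_gt0 ?pi_gt0 // mulr_gt0 ?ltr0n.
apply: sin_gt0_pi; rewrite mulr_gt0 ?ltr0n //= -Mh ltr_pM2r //.
by rewrite -natrM ltr_nat.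
Qed.

Lemma sinhalf_le l : sinhalf l <= 2 * l%:R / M%:R.
Proof.
have h0 : 0 < h by rewrite divr_gt0 ?pi_gt0 // mulr_gt0 ?ltr0n.
apply: (le_trans (sin_le _)); first by rewrite mulr_ge0 ?ler0n // ltW.
have -> : 2 * l%:R / M%:R = 4 * (l%:R / (2 * M%:R)) :> R by field.
have -> : l%:R * h = pi * (l%:R / (2 * M%:R)) by rewrite /h; field.
by rewrite ler_wpM2r ?pi_le4 // divr_ge0 ?mulr_ge0 ?ler0n.
Qed.

(* Telescoping: [2 cos(l (2k+1) h) sin(l h) = sin(2l(k+1)h) - sin(2lkh)]. *)
Lemma sum_cosb_tail l p : (0 < l < 2 * M)%N -> (p <= M)%N ->
  \sum_(p <= k < M) cosb l k = - sinb l p / (2 * sinhalf l).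
Proof.
move=> lM pM; have s0 := sinhalf_gt0 lM.
have s_neq : sinhalf l != 0 by rewrite gt_eqF.
apply: (canRL (mulfK _)); first by rewrite mulf_neq0.
rewrite mulr_suml.
rewrite (telescope_sumr_eq (sinb l)) //.
  have -> : sinb l M = 0.
    rewrite /sinb -(sin_natpi l) -Mh; congr sin; ring.
  by rewrite sub0r.
move=> k _; rewrite /cosb /sinb /sinhalf.
have -> : 2 * l%:R * k.+1%:R * h = l%:R * (2 * k%:R + 1) * h + l%:R * h.
  by rewrite -natr1; ring.
have -> : 2 * l%:R * k%:R * h = l%:R * (2 * k%:R + 1) * h - l%:R * h by ring.
rewrite sinD sinB; ring.
Qed.

Lemma sum_cosb l : (l < 2 * M)%N -> \sum_(k < M) cosb l k = M%:R *+ (l == 0%N).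
Proof.
case: (posnP l) => [-> _|l0 lM].
  rewrite (eq_bigr (fun=> 1)) => [|k _]; last by rewrite /cosb !mul0r cos0.
  by rewrite sumr_const card_ord.
rewrite -(big_mkord xpredT (cosb l)) sum_cosb_tail ?l0 //.
by rewrite /sinb mulr0 mul0r sin0 oppr0 mul0r.
Qed.

(** Multiplication by [sin(l h)] telescopes. Only the parity of [l] matters, which makes the sums
    for [l - m] and [l + m] cancel in [sinb_ortho]. *)
Lemma sum_cos_even l : (0 < l < 2 * M)%N ->
  \sum_(k < M) cos (2 * l%:R * k%:R * h) = (1 - (-1) ^+ l) / 2.
Proof.
move=> lM; have s0 := sinhalf_gt0 lM.
have s_neq : sinhalf l != 0 by rewrite gt_eqF.
apply: (mulIf s_neq); rewrite mulr_suml.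
rewrite -(big_mkord xpredT (fun k => cos (2 * l%:R * k%:R * h) * sinhalf l)).
rewrite (telescope_sumr_eq (fun k => sin (l%:R * (2 * k%:R - 1) * h) / 2)) //.
  have -> : l%:R * (2 * M%:R - 1) * h = l%:R * pi - l%:R * h.
    by rewrite -Mh; ring.
  have -> : l%:R * (2 * 0%:R - 1) * h = - (l%:R * h) by ring.
  rewrite sinB sinN sin_natpi cos_natpi /sinhalf; ring.
move=> k _; rewrite /sinhalf.
have -> : l%:R * (2 * k.+1%:R - 1) * h = 2 * l%:R * k%:R * h + l%:R * h.
  by rewrite -natr1; ring.
have -> : l%:R * (2 * k%:R - 1) * h = 2 * l%:R * k%:R * h - l%:R * h by ring.
by rewrite sinD sinB; field.
Qed.

Lemma cosb_ortho l m : (0 < l < M)%N -> (0 < m < M)%N ->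
  \sum_(k < M) cosb l k * cosb m k = (M%:R / 2) *+ (l == m).
Proof.
(* The product formula uses the natural number [l - m]. *)
wlog lm : l m / (m <= l)%N.
  move=> H hl hm; case: (leqP m l) => [|/ltnW] le; first exact: H.
  by rewrite eq_sym -H //; apply: eq_bigr => k _; rewrite mulrC.
move=> /andP[l0 lM] /andP[m0 mM].
have E k : cosb l k * cosb m k = (cosb (l - m) k + cosb (l + m) k) / 2.
  by rewrite /cosb natrB // natrD !mulrBl !mulrDl cosB cosD; field.
under eq_bigr => k _ do rewrite E.
rewrite -mulr_suml big_split /= !sum_cosb; try lia.
rewrite addn_eq0 (gtn_eqF l0) addr0 subn_eq0 eqn_leq lm andbT.
by case: (l <= m)%N; rewrite // mul0r.
Qed.

Lemma sinb_ortho l m : (0 < l < M)%N -> (0 < m < M)%N ->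
  \sum_(k < M) sinb l k * sinb m k = (M%:R / 2) *+ (l == m).
Proof.
wlog lm : l m / (m <= l)%N.
  move=> H hl hm; case: (leqP m l) => [|/ltnW] le; first exact: H.
  by rewrite eq_sym -H //; apply: eq_bigr => k _; rewrite mulrC.
move=> /andP[l0 lM] /andP[m0 mM].
have E (k : 'I_M) : sinb l k * sinb m k =
    (cos (2 * (l - m)%:R * k%:R * h) - cos (2 * (l + m)%:R * k%:R * h)) / 2.
  rewrite /sinb natrB // natrD; set a := 2 * l%:R * _ * h; set b := 2 * m%:R * _ * h.
  have -> : 2 * (l%:R - m%:R) * k%:R * h = a - b by rewrite /a /b; ring.
  have -> : 2 * (l%:R + m%:R) * k%:R * h = a + b by rewrite /a /b; ring.
  by rewrite cosB cosD; field.
under eq_bigr => k _ do rewrite E.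
rewrite -mulr_suml sumrB (@sum_cos_even (l + m)); last lia.
case: (eqVneq l m) => [->|neq].
  rewrite subnn (eq_bigr (fun=> 1)) => [|k _]; last by rewrite mulr0 !mul0r cos0.
  have -> : (-1) ^+ (m + m) = 1 :> R by rewrite -signr_odd addnn odd_double.
  by rewrite sumr_const card_ord mulr1n; lra.
rewrite sum_cos_even; last by move: lm; rewrite leq_eqVlt eq_sym (negbTE neq); lia.
have -> : (-1) ^+ (l - m) = (-1) ^+ (l + m) :> R.
  by rewrite -signr_odd oddB // -oddD signr_odd.
by rewrite subrr mul0r.
Qed.

End Trig.

(** * Weights of anchored boxes for grid points *)

Section Volume.
Local Open Scope classical_set_scope.
Local Open Scope ring_scope.
Variable R : realType.
Variable M : nat.
Hypothesis M0 : (0 < M)%N.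

Let MR0 : 0 < M%:R :> R. Proof. by rewrite ltr0n. Qed.

(** Half-open, so that cells are disjoint and comparing a grid coordinate with a point of a cell
    amounts to comparing indices. *)
Definition cell (j : nat) : set R := `[j%:R / M%:R, j.+1%:R / M%:R[.

Lemma cellP j t : cell j t <-> j%:R <= t * M%:R < j.+1%:R.
Proof.
rewrite /cell /= in_itv /= ler_pdivrMr // ltr_pdivlMr //.
Qed.

Lemma cell_unique i j t : cell i t -> cell j t -> i = j.
Proof.
move=> /cellP/andP[i1 i2] /cellP/andP[j1 j2].
have := le_lt_trans i1 j2; have := le_lt_trans j1 i2.
by rewrite !ltr_nat; lia.
Qed.

Lemma cell_unit (j : 'I_M) t : cell j t -> 0 <= t < 1.
Proof.
move=> /cellP/andP[j1 j2]; apply/andP; split.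
  by rewrite -(pmulr_lge0 _ MR0) (le_trans _ j1) ?ler0n.
rewrite -(ltr_pM2r MR0) mul1r (lt_le_trans j2) // ler_nat; exact: ltn_ord.
Qed.

Lemma cell_cover (t : R) : 0 <= t < 1 -> exists j : 'I_M, cell j t.
Proof.
move=> /andP[t0 t1].
have tM : 0 <= t * M%:R by rewrite mulr_ge0 ?ler0n.
have /andP[j1 j2] := truncn_itv tM.
have jM : (Num.truncn (t * M%:R) < M)%N.
  by rewrite -(ltr_nat R) (le_lt_trans j1) // gtr_pMl.
by exists (Ordinal jM); apply/cellP; rewrite j1.
Qed.

Lemma vol_seq_ge0 d (S : set (seq R)) : (0 <= vol_seq d S)%E.
Proof.
elim: d S => [|d IH] S /=; first by rewrite lee_fin.
by apply: integral_ge0 => t _; exact: IH.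
Qed.

Lemma integral_step (f : R -> \bar R) (a : 'I_M -> R) :
  (forall t, 0 <= f t)%E -> (forall (j : 'I_M) t, cell j t -> f t = (a j)%:E) ->
  (\int[lebesgue_measure]_(t in `[0%R, 1%R]) f t)%E
  = ((\sum_j a j) / M%:R)%:E.
Proof.
move=> f0 fa.
(* An extra cell [M] catches the endpoint 1, where [f] may even be infinite; it meets the unit
   interval in a null set. *)
pose b (j : 'I_M.+1) := f (j%:R / M%:R).
have cell_left j : cell j (j%:R / M%:R).
  by rewrite cellP divfK ?gt_eqF // lexx ltr_nat ltnSn.
have cellM t : t <= 1 -> cell M t -> t = 1.
  move=> t1 /cellP/andP[Mt _]; apply/le_anti; rewrite t1 /=.
  by rewrite -(ler_pM2r MR0) mul1r.
have fE (t : R) : t \in `[0%R, 1%R]%classic ->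
    f t = (\sum_(j <- index_enum 'I_M.+1) b j * (\1_(cell j) t)%:E)%E.
  rewrite inE /= in_itv /= => /andP[t0 t1].
  have [j tj fj] : exists2 j : 'I_M.+1, cell j t & f t = b j.
    move: t1; rewrite le_eqVlt => /orP[/eqP ->|t1].
      exists ord_max; first by have := cell_left M; rewrite divff ?gt_eqF.
      by rewrite /b /= divff ?gt_eqF.
    have /cell_cover[j tj] : 0 <= t < 1 by rewrite t0.
    exists (widen_ord (leqnSn M) j) => //.
    by rewrite (fa j) // /b (fa j).
  rewrite (bigD1 j) //= indicE mem_set //= mule1 big1 ?adde0 // => i ij.
  rewrite indicE memNset ?mule0 //= => ti; move/eqP: ij; apply; apply: val_inj.
  exact: cell_unique ti tj.
have m01 : measurable (`[0%R, 1%R]%classic : set R) by exact: measurable_itv.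
under eq_integral => t t01 do rewrite fE //.
rewrite ge0_integral_sum //; last 2 first.
- move=> j; apply: emeasurable_funM; first exact: measurable_cst.
  by apply/measurable_EFinP; apply: measurable_indic; exact: measurable_itv.
- by move=> j t _; rewrite mule_ge0 ?lee_fin ?f0.
have intE (j : 'I_M.+1) :
    (\int[lebesgue_measure]_(t in `[0%R, 1%R]) (b j * (\1_(cell j) t)%:E)
    = b j * lebesgue_measure (cell j `&` `[0%R, 1%R]))%E.
  rewrite ge0_integralZl ?integral_indic //; last exact: f0.
    exact: measurable_itv.
  by apply/measurable_EFinP; apply: measurable_indic; exact: measurable_itv.
under eq_bigr => j _ do rewrite intE.
rewrite big_ord_recr /=.
have -> : cell M `&` `[0%R, 1%R] = [set 1].
  apply/seteqP; split=> t /=; rewrite in_itv /=.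
    by move=> [Mt /andP[_ t1]]; exact: cellM.
  move=> ->; rewrite ler01 lexx; split => //.
  by have := cell_left M; rewrite divff ?gt_eqF.
rewrite lebesgue_measure_set1 mule0 adde0 mulr_suml -sumEFin.
apply: eq_bigr => j _; rewrite /b /= (fa j) // EFinM; congr (_ * _)%E.
rewrite (_ : _ `&` _ = cell j); last first.
  apply: setIidl => t tj /=; rewrite in_itv /=.
  by have /andP[-> /ltW] := cell_unit tj.
rewrite /cell lebesgue_measure_itv /= lte_fin ltr_pM2r ?invr_gt0 // ltr_nat ltnSn.
by rewrite -EFinD -mulrBl -natr1 addrAC subrr add0r mul1r.
Qed.

Definition in_cell d (x : {ffun 'I_d -> 'I_M}) (s : seq R) : Prop :=
  size s = d /\ forall i : 'I_d, cell (x i) (nth 0 s i).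

(** Induction on [d]: the volume of a slice is constant as the first coordinate runs through a cell,
    so [integral_step] applies. Points with a coordinate equal to 1 lie in no cell and are
    negligible. *)
Lemma vol_seq_cells d (S : set (seq R)) (A : pred {ffun 'I_d -> 'I_M}) :
  (forall x s, in_cell x s -> S s <-> A x) ->
  vol_seq d S = (\sum_x (A x)%:R / M%:R ^+ d)%:E.
Proof.
elim: d S A => [|d IH] S A SA /=.
  have [x0 _] : {x0 : {ffun 'I_0 -> 'I_M} | True} by exists [ffun i => ffun0 (card_ord 0) i].
  have all0 x : x = x0 by apply/ffunP => -[].
  rewrite (eq_bigl (pred1 x0)) => [|x]; last by rewrite /= (all0 x) eqxx.
  rewrite big_pred1_eq expr0 divr1 indicE.
  have SAx : S [::] <-> A x0 by apply: SA; split=> // -[].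
  congr (_%:R)%:E; congr nat_of_bool.
  by apply/idP/idP; rewrite inE SAx.
rewrite (@integral_step _ (fun j => \sum_x (A (ffcons j x))%:R / M%:R ^+ d)).
- congr EFin; rewrite big_ffcons mulr_suml; apply: eq_bigr => j _.
  rewrite mulr_suml; apply: eq_bigr => x _.
  by rewrite exprSr invfM mulrA.
- by move=> t; exact: vol_seq_ge0.
move=> j t tj; apply: IH => x s [ss xs] /=.
apply: SA; split=> [|i]; first by rewrite /= ss.
by case: (unliftP ord0 i) => [k ->|->]; rewrite ?ffconsS ?ffcons0 //=; exact: xs.
Qed.

Definition gridpt d (x : {ffun 'I_d -> 'I_M}) : d.-tuple R :=
  [tuple (x i)%:R / M%:R | i < d].

Lemma tnth_gridpt d (x : {ffun 'I_d -> 'I_M}) i :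
  tnth (gridpt x) i = (x i)%:R / M%:R.
Proof. by rewrite tnth_mktuple. Qed.

Lemma gridpt_unit d (x : {ffun 'I_d -> 'I_M}) : in_unit_cube (gridpt x).
Proof.
move=> i; rewrite tnth_gridpt divr_ge0 ?ler0n //=.
by rewrite ler_pdivrMr // mul1r ler_nat ltnW.
Qed.

Lemma gridpt_inj d : injective (@gridpt d).
Proof.
move=> x y xy; apply/ffunP => i; apply: val_inj => /=.
have := congr1 (fun t => tnth t i) xy; rewrite /= !tnth_gridpt.
move=> /(mulIf _); rewrite invr_eq0 gt_eqF // => /(_ isT) /eqP.
by rewrite eqr_nat => /eqP.
Qed.

Definition gtrace d n (g : 'I_n -> {ffun 'I_d -> 'I_M}) (x : {ffun 'I_d -> 'I_M}) :
  {set 'I_n} := [set k | [forall i, g k i <= x i]%N]%SET.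

Lemma trace_cell d n (g : 'I_n -> {ffun 'I_d -> 'I_M}) (x : {ffun 'I_d -> 'I_M})
    (t : d.-tuple R) :
  (forall i, cell (x i) (tnth t i)) -> trace (fun k => gridpt (g k)) t = gtrace g x.
Proof.
move=> xt; apply/setP => k; rewrite !inE; apply/asboolP/forallP => [H i|H i].
  have /andP[_] := H i; rewrite tnth_gridpt ler_pdivrMr // => gt.
  have /cellP/andP[_ tx] := xt i.
  by rewrite -ltnS -(ltr_nat R) (le_lt_trans gt).
rewrite tnth_gridpt divr_ge0 ?ler0n //= ler_pdivrMr //.
have /cellP/andP[xt' _] := xt i.
by rewrite (le_trans _ xt') // ler_nat.
Qed.

Lemma wbar_grid d n (g : 'I_n -> {ffun 'I_d -> 'I_M}) (F : {set 'I_n}) :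
  wbar (fun k => gridpt (g k)) F = \sum_x (gtrace g x == F)%:R / M%:R ^+ d.
Proof.
rewrite /wbar /lebd (@vol_seq_cells d _ (fun x => gtrace g x == F)) //.
move=> x s [ss xs]; split=> [[t [ts [_ <-]]]|/eqP <-].
  apply/eqP/esym; apply: trace_cell => i; rewrite (tnth_nth 0) ts; exact: xs.
exists (tcast ss (in_tuple s)); rewrite val_tcast; split=> //.
have xt i : cell (x i) (tnth (tcast ss (in_tuple s)) i).
  by rewrite (tnth_nth 0) val_tcast; exact: xs.
split; last exact: trace_cell.
by move=> i; have /andP[-> /ltW] := cell_unit (xt i).
Qed.

(** Each cell gives [1 / M^d] to the weight of exactly one set, its trace, which is in the system as
    the trace of the corner of the cell. Regrouping turns weighted sums into grid means. *)
Lemma sum_wbar_grid d n (g : 'I_n -> {ffun 'I_d -> 'I_M}) (phi : {set 'I_n} -> R) :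
  \sum_(F in anchored_system (fun k => gridpt (g k)))
     wbar (fun k => gridpt (g k)) F * phi F
  = (\sum_x phi (gtrace g x)) / M%:R ^+ d.
Proof.
under eq_bigr => F _ do rewrite wbar_grid mulr_suml.
rewrite exchange_big mulr_suml /=; apply: eq_bigr => x _.
have xin : gtrace g x \in anchored_system (fun k => gridpt (g k)).
  rewrite inE; apply/asboolP; exists (gridpt x); split; first exact: gridpt_unit.
  apply: trace_cell => i; rewrite cellP tnth_gridpt divfK ?gt_eqF //.
  by rewrite lexx ltr_nat ltnSn.
rewrite (bigD1 _ xin) /= eqxx big1 ?addr0; last first.
  by move=> F /andP[_ Fx]; rewrite eq_sym (negbTE Fx) !mul0r.
by rewrite mul1r mulrC.
Qed.

End Volume.

(** * The hyperbolic cross *)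

Section HyperbolicCross.
Variable R : realType.

(** Positive factors of a product at most [Q] are at most [Q], so the bounded index type loses
    nothing; with [M = Q.+1] it also indexes the grid and keeps frequencies below [M]. *)
Definition hcross d Q (l : {ffun 'I_d -> 'I_Q.+1}) : bool :=
  [forall i, 0 < l i]%N && (\prod_i l i <= Q)%N.

Definition hcrossT d Q : finType := {l : {ffun 'I_d -> 'I_Q.+1} | hcross l}.

Lemma sum_bounded_index Q q : (q <= Q)%N -> (\sum_(t < Q.+1) (0 < t <= q)%N = q)%N.
Proof.
move=> qQ; rewrite big_ord_recl add0n /=.
rewrite (eq_bigr (fun t : 'I_Q => if (t < q)%N then 1%N else 0%N)) => [|t _]; last first.
  by rewrite /bump leq0n add1n; case: (t < q)%N.
rewrite -big_mkcond -(big_ord_widen Q (fun=> 1%N)) //.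
by rewrite sum1_card card_ord.
Qed.

Lemma harmonic_ge_ln (L : nat) :
  ln L.+1%:R <= \sum_(t < L) (t.+1%:R)^-1 :> R.
Proof.
elim: L => [|L IH]; first by rewrite big_ord0 ln1.
rewrite big_ord_recr /=; apply: le_trans (lerD IH (lexx _)).
have -> : L.+2%:R = L.+1%:R * (1 + L.+1%:R^-1) :> R.
  by rewrite mulrDr mulr1 divff ?pnatr_eq0 // -natr1.
rewrite lnM ?posrE ?ltr0n ?addr_gt0 ?invr_gt0 ?ltr0n // lerD2l.
by apply: le_ln1Dx; rewrite (lt_le_trans (ltrN10 _)) // invr_ge0 ler0n.
Qed.

(** With the last [d] coordinates in [1..L], their product [P] is at most [Q], and the first
    coordinate has [Q %/ P] choices. The sum of [1/P] factors into the [d]-th power of a harmonic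
    sum. *)
Lemma card_hcross d (L : nat) : (0 < L)%N -> (0 < d)%N ->
  (L ^ d)%:R / 2 * ln L.+1%:R ^+ d <= #|hcrossT d.+1 (L ^ d)|%:R :> R.
Proof.
move=> L0 d0; set Q := (L ^ d)%N.
have LQ : (L <= Q)%N by rewrite /Q -[d]prednK // expnS leq_pmulr // expn_gt0 L0.
rewrite /hcrossT card_sig -sum1_card big_mkcond /= big_ffcons exchange_big /=.
rewrite natr_sum.
pose ok (t : 'I_Q.+1) := (0 < t <= L)%N.
apply: (@le_trans _ _ (\sum_(l : {ffun 'I_d -> 'I_Q.+1})
    Q%:R / 2 * \prod_i ((ok (l i))%:R / (l i)%:R))); last first.
  apply: ler_sum => l _; case: (boolP [forall i, ok (l i)]) => [/forallP okl|].
    pose P := (\prod_i l i)%N.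
    have P0 : (0 < P)%N by apply: prodn_gt0 => i; have /andP[] := okl i.
    have PQ : (P <= Q)%N.
      have -> : Q = (\prod_(i < d) L)%N by rewrite prod_nat_const card_ord.
      by apply: leq_prod => i _; have /andP[] := okl i.
    apply: (@le_trans _ _ (Q %/ P)%:R).
      rewrite (eq_bigr (fun i => ((l i)%:R)^-1)) => [|i _]; last by rewrite okl mul1r.
      (* Since [Q %/ P >= 1], halving [Q/P] makes up for rounding down. *)
      rewrite prodfV -natr_prod -/P ler_pdivrMr ?ltr0n // ler_pdivrMr ?ltr0n //.
      rewrite -!natrM ler_nat.
      have := divn_eq Q P; have := ltn_pmod Q P0.
      have : (0 < Q %/ P)%N by rewrite divn_gt0.
      nia.
    rewrite ler_nat -[in leqLHS](sum_bounded_index (leq_div Q P)).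
    apply: leq_sum => t _; case: (boolP (0 < t <= _)%N) => //= /andP[t0 tq].
    rewrite /in_mem /= /hcross big_ord_recl ffcons0.
    rewrite (eq_bigr (fun i => l i : nat)) => [|i _]; last by rewrite ffconsS.
    rewrite -leq_divRL // tq andbT.
    rewrite (introT forallP) // => i.
    by case: (unliftP ord0 i) => [j ->|->]; rewrite ?ffconsS ?ffcons0 //; case/andP: (okl j).
  rewrite negb_forall => /existsP[i /negbTE oki].
  by rewrite (bigD1 i) //= oki !mul0r mulr0 ler0n.
rewrite -mulr_sumr -(bigA_distr_bigA (fun _ (t : 'I_Q.+1) => (ok t)%:R / t%:R)) /=.
rewrite prodr_const card_ord ler_wpM2l ?divr_ge0 ?ler0n //.
rewrite lerXn2r ?nnegrE ?ln_ge0 ?ler1n //.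
  by apply: sumr_ge0 => t _; rewrite divr_ge0 ?ler0n.
apply: (le_trans (harmonic_ge_ln L)).
rewrite big_ord_recl /ok /= mul0r add0r.
rewrite (big_ord_widen Q (fun t => t.+1%:R^-1 : R)) // big_mkcond /=.
by apply: ler_sum => t _; rewrite /bump leq0n add1n; case: (t < L)%N; rewrite ?mul1r ?mul0r.
Qed.

(** The sum factors over the coordinates; if [l] and [m] differ somewhere, the factor there
    vanishes. *)
Lemma tensor_ortho M d (f : 'I_M -> 'I_M -> R) (P : pred 'I_M) k
    (l m : {ffun 'I_d -> 'I_M}) :
  (forall a b, P a -> P b -> \sum_x f a x * f b x = k *+ (a == b)) ->
  (forall i, P (l i)) -> (forall i, P (m i)) ->
  \sum_(x : {ffun 'I_d -> 'I_M}) (\prod_i f (l i) (x i)) * (\prod_i f (m i) (x i))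
  = k ^+ d *+ (l == m).
Proof.
move=> fk Pl Pm; under eq_bigr => x _ do rewrite -big_split.
rewrite -(bigA_distr_bigA (fun i x => f (l i) x * f (m i) x)) /=.
under eq_bigr => i _ do rewrite fk //.
case: eqVneq => [->|neq].
  by under eq_bigr => i _ do rewrite eqxx; rewrite prodr_const card_ord.
have [i li] : exists i, l i != m i.
  apply/existsP; rewrite -negb_forall; apply: contra neq => /forallP H.
  by apply/eqP/ffunP => i; apply/eqP.
by rewrite (bigD1 i) //= (negbTE li) mul0r.
Qed.

(** * Tensor products over the hyperbolic cross and Bessel's inequality *)

Variables (d Q : nat).
Hypothesis Q0 : (0 < Q)%N.
Let M := Q.+1.
Let M0 : (0 < M)%N. Proof. by []. Qed.
Let X := {ffun 'I_d -> 'I_M}.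
Let MR0 : 0 < M%:R :> R. Proof. by rewrite ltr0n. Qed.

(** The argument orders differ on purpose: [sinv x] is a vector indexed by frequencies, [cosv l] a
    function on the grid. *)
Definition sinv (x : X) (l : hcrossT d Q) : R := \prod_i sinb R M (val l i) (x i).
Definition cosv (l : hcrossT d Q) (x : X) : R := \prod_i cosb R M (val l i) (x i).

Lemma hcross_gt0 (l : hcrossT d Q) i : (0 < val l i)%N.
Proof. by have /andP[/forallP] := valP l. Qed.

Lemma sinv_orthofam : orthofam ((M%:R / 2) ^+ d) (fun l x => sinv x l).
Proof.
move=> l m; rewrite /dot /sinv.
apply: (@tensor_ortho M d (fun a x => sinb R M a x) (fun a => 0 < a)%N).
- by move=> a b a0 b0; rewrite sinb_ortho ?a0 ?b0 ?ltn_ord.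
- exact: hcross_gt0.
- exact: hcross_gt0.
Qed.

Lemma cosv_orthofam : orthofam ((M%:R / 2) ^+ d) cosv.
Proof.
move=> l m; rewrite /dot /cosv.
apply: (@tensor_ortho M d (fun a x => cosb R M a x) (fun a => 0 < a)%N).
- by move=> a b a0 b0; rewrite cosb_ortho ?a0 ?b0 ?ltn_ord.
- exact: hcross_gt0.
- exact: hcross_gt0.
Qed.

Definition boxind (p x : X) : R := [forall i, p i <= x i]%N%:R.

(** The indicator is a product over coordinates, so the inner product factors into the tail sums of
    [sum_cosb_tail]. *)
Lemma dot_boxind_cosv p l :
  dot (boxind p) (cosv l) = sinv p l * \prod_i (- (2 * sinhalf R M (val l i))^-1).
Proof.
rewrite /sinv -big_split /=.
under [RHS]eq_bigr => i _.
  rewrite mulrN -mulNr -sum_cosb_tail ?(ltnW (ltn_ord _)) //; last first.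
    by rewrite hcross_gt0 (leq_trans (ltn_ord _)) // mul2n -addnn leq_addr.
  rewrite (big_nat_widenl _ 0) // big_mkord big_mkcond /=.
  over.
rewrite bigA_distr_bigA /=; apply: eq_bigr => x _.
rewrite /boxind /cosv; case: (boolP [forall i, _]) => [/forallP H|].
  by rewrite mul1r; apply: eq_bigr => i _; rewrite H.
rewrite negb_forall => /existsP[i /negbTE pi].
by rewrite mul0r (bigD1 i) //= pi mul0r.
Qed.

(** Each factor is at least [M^2 / (16 l_i^2)] by [sinhalf_le], and the [l_i] have product at most
    [Q]. *)
Lemma prod_sinhalf_ge (l : hcrossT d Q) :
  (M%:R ^+ 2 / 16) ^+ d / Q%:R ^+ 2
  <= (\prod_i (- (2 * sinhalf R M (val l i))^-1)) ^+ 2.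
Proof.
rewrite -prodrXl.
apply: (@le_trans _ _ (\prod_(i < d) (M%:R ^+ 2 / 16 * ((val l i)%:R ^+ 2)^-1))).
  rewrite big_split /= prodr_const card_ord ler_wpM2l ?exprn_ge0 ?divr_ge0 ?sqr_ge0 //.
  rewrite prodfV lef_pV2 ?posrE ?exprn_gt0 ?ltr0n //; last first.
    by apply: prodr_gt0 => i _; rewrite exprn_gt0 ?ltr0n ?hcross_gt0.
  rewrite prodrXl lerXn2r ?nnegrE ?prodr_ge0 //.
  by rewrite -natr_prod ler_nat; have /andP[] := valP l.
apply: ler_prod => i _.
have l0 : 0 < (val l i)%:R :> R by rewrite ltr0n hcross_gt0.
apply/andP; split; first by rewrite mulr_ge0 ?divr_ge0 ?sqr_ge0 ?invr_ge0 ?sqr_ge0.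
have s0 : 0 < sinhalf R M (val l i).
  apply: sinhalf_gt0 => //.
  by rewrite hcross_gt0 (leq_trans (ltn_ord _)) // mul2n -addnn leq_addr.
have sl := @sinhalf_le R M M0 (val l i).
rewrite sqrrN exprVn.
have -> : M%:R ^+ 2 / 16 * ((val l i)%:R ^+ 2)^-1
    = ((2 * (2 * (val l i)%:R / M%:R)) ^+ 2)^-1 :> R.
  by field; rewrite !gt_eqF.
rewrite lef_pV2 ?posrE ?exprn_gt0 ?mulr_gt0 ?invr_gt0 //.
rewrite lerXn2r ?nnegrE ?mulr_ge0 ?invr_ge0 ?ler0n ?(ltW s0) //.
by rewrite ler_pM2l.
Qed.

(** Bessel for [cosv], whose coefficients are known from [dot_boxind_cosv]; the constant is
    [(M^2/16)^d / Q^2] divided by [(M/2)^d]. *)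
Lemma box_discrepancy_ge n (g : 'I_n -> X) (c : 'I_n -> R) :
  M%:R ^+ d / (8 ^+ d * Q%:R ^+ 2) * \sum_l (\sum_k c k * sinv (g k) l) ^+ 2
  <= \sum_x (\sum_k c k * boxind (g k) x) ^+ 2.
Proof.
have k0 : 0 < (M%:R / 2) ^+ d :> R by rewrite exprn_gt0 ?divr_gt0.
rewrite -(ler_pM2l k0).
have := bessel (fun x => \sum_k c k * boxind (g k) x) k0 cosv_orthofam.
rewrite [X in _ <= _ * X](_ : _ = \sum_x (\sum_k c k * boxind (g k) x) ^+ 2); last first.
  by apply: eq_bigr => x _; rewrite expr2.
apply: le_trans; rewrite mulrA mulr_sumr; apply: ler_sum => l _.
rewrite dot_suml.
under [X in _ <= X ^+ 2]eq_bigr => k _ do rewrite dot_boxind_cosv mulrA.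
rewrite -mulr_suml [leRHS]exprMn [leLHS]mulrC ler_wpM2l ?sqr_ge0 //.
apply: le_trans (prod_sinhalf_ge l).
rewrite le_eqVlt; apply/orP; left; apply/eqP.
have -> : (M%:R ^+ 2 / 16) ^+ d = (M%:R / 2) ^+ d * (M%:R ^+ d / 8 ^+ d) :> R.
  by rewrite -expr_div_n -exprMn; congr (_ ^+ d); field.
by rewrite invfM -!mulrA.
Qed.

End HyperbolicCross.

(** * Grid sets of large discrepancy *)

Section GridSet.
Variable R : realType.

Lemma exists_grid_set d Q : (0 < Q)%N -> (0 < #|hcrossT d Q|)%N ->
  exists n (g : 'I_n -> {ffun 'I_d -> 'I_Q.+1}),
  injective g /\ forall col : {ffun 'I_n -> bool},
    (#|hcrossT d Q|%:R / (256 * 4 ^+ d * Q%:R)) ^+ 2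
    <= (\sum_x colsum R col (gtrace g x) ^+ 2) / Q.+1%:R ^+ d.
Proof.
move=> Q0 N0; set N := #|hcrossT d Q| in N0 *; set M := Q.+1.
have MR0 : 0 < M%:R :> R by rewrite ltr0n.
pose X := {ffun 'I_d -> 'I_M}.
have cardX : #|{: X}| = (M ^ d)%N by rewrite card_ffun !card_ord.
have X0 : (0 < #|{: X}|)%N by rewrite cardX expn_gt0.
(* Family constant [(M/2)^d] over [M^d] points gives [2^-d], and at least [N/2] dimensions remain at
   each of the [uphalf N] picks. *)
pose D : R := N%:R / 2 / 2 ^+ d.
have D0 : 0 < D by rewrite !divr_gt0 ?exprn_gt0 ?ltr0n.
have [|p [e [oe _ tri far]]] :=
    @gram_schmidt R X _ _ (@sinv R d Q) (uphalf N) D X0 D0 (@sinv_orthofam R d Q).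
  move=> i iN; rewrite cardX natrX expr_div_n -mulrA mulrC -/N.
  have -> : (N%:R - i%:R) / M%:R ^+ d * (M%:R ^+ d / 2 ^+ d)
      = (N%:R - i%:R) / 2 ^+ d :> R.
    by field; rewrite !expf_neq0 ?pnatr_eq0.
  rewrite ler_pM2r ?invr_gt0 ?exprn_gt0 //.
  have : (2 * i <= N)%N by lia.
  rewrite -(ler_nat R) natrM; lra.
pose m := uphalf N.
have m0 : (0 < m)%N by rewrite /m; lia.
have [|||S hS] :=
    @exists_uncolorable_subset R _ m (fun j => sinv R (p j)) (fun i => e i) D m0 D0.
- by move=> i j; rewrite oe // .
- by move=> i j ji; apply: tri; rewrite ji ltn_ord.
- by move=> i; apply: far.
pose g (k : 'I_#|S|) : X := p (enum_val k).
(* A repeated point would have its later diagonal entry equal to 0. *)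
have p_inj (i j : 'I_m) : (i < j)%N -> p i != p j.
  move=> ij; apply/eqP => pij; have := far j (ltn_ord j).
  by rewrite -pij tri ?ij ?ltn_ord // expr0n /= leNgt D0.
exists #|S|, g; split.
  move=> k k' gk; apply: enum_val_inj; apply: val_inj => /=.
  case: (ltngtP (enum_val k) (enum_val k')) => // /p_inj /eqP; rewrite ?gk //.
  by case; rewrite -/(g k) gk.
move=> col.
(* Extends the colouring of [S] to all picked points, as [hS] expects. *)
pose col' : {ffun 'I_m -> bool} := [ffun j => [exists k, (enum_val k == j) && col k]].
have col'E k : col' (enum_val k) = col k.
  rewrite ffunE; apply/existsP/idP => [[k' /andP[/eqP/enum_val_inj -> //]]|ck].
  by exists k; rewrite eqxx.
have {hS} := hS col'.
have -> : \sum_l (\sum_(j in S) sgb R (col' j) * sinv R (p j) l) ^+ 2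
    = \sum_l (\sum_k sgb R (col k) * sinv R (g k) l) ^+ 2.
  apply: eq_bigr => l _; congr (_ ^+ 2); rewrite big_enum_val /=.
  by apply: eq_bigr => k _; rewrite col'E.
move=> hS; rewrite ler_pdivlMr ?exprn_gt0 //.
have -> : \sum_x colsum R col (gtrace g x) ^+ 2
    = \sum_x (\sum_k sgb R (col k) * boxind R (g k) x) ^+ 2.
  apply: eq_bigr => x _; congr (_ ^+ 2); rewrite /colsum big_mkcond /=.
  apply: eq_bigr => k _; rewrite inE /boxind /sgb.
  by case: [forall i, _]; rewrite ?mulr1 ?mulr0.
apply: le_trans (box_discrepancy_ge Q0 g _); rewrite -/M.
have QR0 : 0 < Q%:R :> R by rewrite ltr0n.
rewrite [leLHS]mulrC -[leRHS]mulrA ler_wpM2l ?exprn_ge0 ?ler0n //.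
rewrite ler_pdivlMl ?mulr_gt0 ?exprn_gt0 //; apply: le_trans hS.
have -> : 8 ^+ d * Q%:R ^+ 2 * (N%:R / (256 * 4 ^+ d * Q%:R)) ^+ 2
    = D * (N%:R / 2) / 128 ^+ 2 :> R.
  have e8 : 8 ^+ d = 2 ^+ d ^+ 3 :> R by rewrite -exprM mulnC exprM; congr (_ ^+ d); ring.
  have e4 : 4 ^+ d = 2 ^+ d ^+ 2 :> R by rewrite -exprM mulnC exprM; congr (_ ^+ d); ring.
  rewrite /D e8 e4; field.
  by rewrite expf_neq0 ?gt_eqF.
rewrite ler_pM2r ?invr_gt0 ?exprn_gt0 // ler_pM2l // ler_pdivrMr // -natrM ler_nat /m.
lia.
Qed.

(** The total weight is 1, so the squared value of a colouring is a grid mean. The bound holds for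
    every colouring, in particular for the minimiser. *)
Lemma disc2_grid d n M (g : 'I_n -> {ffun 'I_d -> 'I_M}) (a : R) : (0 < M)%N ->
  0 <= a ->
  (forall col : {ffun 'I_n -> bool},
     a ^+ 2 <= (\sum_x colsum R col (gtrace g x) ^+ 2) / M%:R ^+ d) ->
  a <= disc2 (anchored_system (fun k => gridpt R (g k))) (wbar (fun k => gridpt R (g k))).
Proof.
move=> M0 a0 ha; rewrite /disc2; move: (Order.arg_min _ _ _) => col.
rewrite /disc2_val.
have := @sum_wbar_grid R M M0 d n g (fun=> 1).
under eq_bigr => F _ do rewrite mulr1.
move=> ->; rewrite (sum_wbar_grid M0 g (fun F => `|colsum R col F| ^+ 2)).
have -> : (\sum_(x : {ffun 'I_d -> 'I_M}) 1) / M%:R ^+ d = 1 :> R.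
  by rewrite sumr_const card_ffun !card_ord natrX divff // expf_neq0 // pnatr_eq0 -lt0n.
rewrite invr1 mul1r.
under eq_bigr => x _ do rewrite real_normK ?num_real //.
by rewrite -(ger0_norm a0) -sqrtr_sqr ler_wsqrtr.
Qed.

(** Discrepancy never exceeds [n], so large discrepancy forces many points. *)
Lemma colsum_sqr_le n (col : {ffun 'I_n -> bool}) F :
  colsum R col F ^+ 2 <= n%:R ^+ 2.
Proof.
rewrite -[leLHS]real_normK ?num_real // lerXn2r ?nnegrE ?ler0n //.
apply: le_trans (ler_norm_sum _ _ _) _.
apply: (@le_trans _ _ (\sum_(i in F) 1)).
  by apply: ler_sum => i _; case: (col i); rewrite ?normrN normr1.
by rewrite sumr_const ler_nat -[leqRHS](card_ord n) max_card.
Qed.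

End GridSet.

Theorem theorem7p1 (R : realType) (d : nat) (hd : (2 <= d)%N) :
  exists c : R, 0 < c /\
    forall N : nat, exists n : nat, (N <= n)%N /\
      exists p : 'I_n -> d.-tuple R,
        injective p /\ (forall i, in_unit_cube (p i)) /\
        c * ln (n%:R) ^+ (d.-1) <= disc2 (anchored_system p) (wbar p).
Proof.
case: d hd => [//|d]; rewrite ltnS => d0 /=.
(* [B] joins the 256 of [exists_grid_set] with the 1/2 of [card_hcross]; [e] is such that
   [n <= (L+1)^e]. *)
pose B : R := 512 * 4 ^+ d.+1; pose e := (d * d.+1)%N.
have B0 : 0 < B by rewrite mulr_gt0 ?exprn_gt0.
have e0 : 0 < e%:R :> R by rewrite ltr0n muln_gt0 d0.
exists (B * e%:R ^+ d)^-1; split; first by rewrite invr_gt0 mulr_gt0 ?exprn_gt0.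
move=> N0.
(* [y / B >= N0] will force [n >= N0], and [y >= 1] gives [h <= h^d]. *)
pose y : R := B * N0%:R + 1.
have y1 : 1 <= y by rewrite lerDr mulr_ge0 ?ler0n ?ltW.
pose L := (Num.truncn (expR y)).+1.
pose h : R := ln L.+1%:R.
have yh : y <= h.
  rewrite /h -[leLHS]expRK ler_ln ?posrE ?expR_gt0 ?ltr0n //.
  have /andP[_ /ltW] := truncn_itv (expR_ge0 y).
  by move=> /le_trans; apply; rewrite ler_nat.
have h0 : 0 <= h by apply: le_trans yh; apply: le_trans y1.
pose Q := (L ^ d)%N.
have Q0 : (0 < Q)%N by rewrite expn_gt0.
have QR0 : 0 < Q%:R :> R by rewrite ltr0n.
have cardH : Q%:R / 2 * h ^+ d <= #|hcrossT d.+1 Q|%:R :> R by exact: card_hcross.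
have hd0 : 0 < h ^+ d by rewrite exprn_gt0 // (lt_le_trans _ yh) // (lt_le_trans _ y1).
have H0 : (0 < #|hcrossT d.+1 Q|)%N.
  by rewrite -(ltr_nat R) (lt_le_trans _ cardH) // mulr_gt0 ?divr_gt0.
have [n [g [g_inj hg]]] := @exists_grid_set R _ _ Q0 H0.
set a := (_ / _) in hg.
have a0 : 0 <= a by rewrite divr_ge0 ?mulr_ge0 ?exprn_ge0 ?ler0n.
have ha : h ^+ d / B <= a.
  rewrite /a ler_pdivlMr ?mulr_gt0 ?exprn_gt0 //; apply: le_trans cardH.
  rewrite le_eqVlt /B; apply/orP; left; apply/eqP; field.
  by rewrite expf_neq0.
have nN : (N0 <= n)%N.
  have an : a <= n%:R.
    rewrite -ler_sqr ?nnegrE ?ler0n //.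
    apply: (le_trans (hg [ffun=> true])); rewrite ler_pdivrMr ?exprn_gt0 ?ltr0n //.
    apply: (le_trans (ler_sum _ (fun x _ => colsum_sqr_le _ _ _))).
    by rewrite sumr_const card_ffun !card_ord -[leLHS]mulr_natr natrX.
  rewrite -(ler_nat R); apply: le_trans an; apply: le_trans ha.
  rewrite ler_pdivlMr //; apply: (@le_trans _ _ y).
    by rewrite /y mulrC lerDl.
  apply: (le_trans yh); rewrite -[d]prednK // exprS ler_peMr // exprn_ege1 //.
  exact: le_trans yh.
exists n; split=> //; exists (fun k => gridpt R (g k)); split.
  by move=> i j /(gridpt_inj (ltn0Sn _)) /g_inj.
split; first by move=> i; exact: gridpt_unit.
apply: le_trans (disc2_grid _ a0 hg) => //; apply: le_trans ha.
rewrite invfM mulrAC [leRHS]mulrC -mulrA ler_pM2l ?invr_gt0 //.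
rewrite mulrC ler_pdivrMl ?exprn_gt0 // -exprMn.
(* The points are distinct, so [n <= (Q+1)^(d+1)], and [Q + 1 <= (L+1)^d]. For [n = 0], [ln] takes
   the value 0. *)
have lnn : ln n%:R <= e%:R * h.
  have [->|n0] := posnP n; first by rewrite ln0 // mulr_ge0 // ltW.
  rewrite /h mulr_natl -lnXn ?ltr0n // ler_ln ?posrE ?exprn_gt0 ?ltr0n //.
  rewrite -natrX ler_nat -(card_ord n).
  apply: (leq_trans (leq_card _ g_inj)); rewrite card_ffun !card_ord /e expnM leq_exp2r //.
  by rewrite ltn_exp2r.
rewrite lerXn2r ?nnegrE //; last by rewrite mulr_ge0 // ltW.
by have [->|n0] := posnP n; [rewrite ln0|rewrite ln_ge0 ?ler1n].
Qed.
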